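(* Let $\mathcal{C}$ be a permutation class, and let $\mathcal{C}^{+1}$ be the class of its one-point extensions. Then $\mathcal{C}$ is labelled well-quasi-ordered (lwqo) if and only if $\mathcal{C}^{+1}$ is lwqo.
   Context: A permutation of length $n$ is an arrangement $\pi=\pi(1)\cdots\pi(n)$ of $1,\dots,n$ (the empty permutation is allowed). The permutation $\sigma$ of length $k$ is contained in $\pi$ of length $n$, written $\sigma\le\pi$, if there are indices $1\le i_1<\cdots<i_k\le n$ such that $\pi(i_1)\cdots\pi(i_k)$ is order isomorphic to $\sigma$. A permutation class is a set of permutations closed downward under containment. For a class $\mathcal{C}$, $\mathcal{C}^{+1}$ is the set of all permutations $\pi$ from which one can remove at most one entry (and then reduce the remaining entries to the permutation order isomorphic to them) so as to obtain a member of $\mathcal{C}$; it is a permutation class containing $\mathcal{C}$. A quasi-order $(Y,\le)$ is well-quasi-ordered (wqo) if every infinite sequence $y_1,y_2,\dots$ in $Y$ has indices $i<j$ with $y_i\le y_j$. Given a quasi-order $(L,\le_L)$, an $L$-labelled permutation is a pair $(\pi,\ell_\pi)$ with $\pi$ a permutation of length $n$ and $\ell_\pi:\{1,\dots,n\}\to L$. We say $(\sigma,\ell_\sigma)\le(\pi,\ell_\pi)$, where $\sigma$ and $\pi$ have lengths $k$ and $n$, if there are indices $1\le i_1<\cdots<i_k\le n$ such that $\pi(i_1)\cdots\pi(i_k)$ is order isomorphic to $\sigma$ and $\ell_\sigma(j)\le_L\ell_\pi(i_j)$ for all $1\le j\le k$. For a set $X$ of permutations, $X\wr L$ is the set of all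 $L$-labelled members of $X$ under this order. The set $X$ is labelled well-quasi-ordered (lwqo) if $X\wr L$ is wqo for every wqo $(L,\le_L)$. *)

(* Defs.v *)
From mathcomp Require Import all_boot all_fingroup.
From Stdlib Require RelationClasses.

Set Implicit Arguments.
Unset Strict Implicit.
Unset Printing Implicit Defensive.

(* Lengths, positions and values are numbered from 0: a permutation of length n
   is an element of 'S_n, and 'S_0 consists of the empty permutation. *)
Definition perm_set := forall n : nat, 'S_n -> Prop.

Definition increasing (k n : nat) (f : 'I_k -> 'I_n) : Prop :=
  forall i j : 'I_k, i < j -> f i < f j.

Definition order_isomorphic (k : nat) (u v : 'I_k -> nat) : Prop :=
  forall i j : 'I_k, (u i < u j) = (v i < v j).

Definition embedding (k n : nat) (s : 'S_k) (p : 'S_n) (f : 'I_k -> 'I_n)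
    : Prop :=
  increasing f /\ order_isomorphic (fun j => s j) (fun j => p (f j)).

Definition contained (k n : nat) (s : 'S_k) (p : 'S_n) : Prop :=
  exists f : 'I_k -> 'I_n, embedding s p f.

Definition perm_class (C : perm_set) : Prop :=
  forall (k n : nat) (s : 'S_k) (p : 'S_n), contained s p -> C n p -> C k s.

(* s is what p reduces to once the entries at the positions in D are removed:
   f enumerates the remaining positions increasingly. *)
Definition reduces_to (n k : nat) (p : 'S_n) (D : {set 'I_n}) (s : 'S_k)
    : Prop :=
  exists f : 'I_k -> 'I_n, embedding s p f /\ [set f j | j : 'I_k] = ~: D.

Definition one_point_extension (C : perm_set) : perm_set :=
  fun n p => exists (D : {set 'I_n}) (k : nat) (s : 'S_k),
    [/\ #|D| <= 1, reduces_to p D s & C k s].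

Definition wqo (Y : Type) (le : Y -> Y -> Prop) : Prop :=
  RelationClasses.PreOrder le /\
  forall y : nat -> Y, exists i j : nat, i < j /\ le (y i) (y j).

Record labelled (X : perm_set) (L : Type) : Type := Labelled {
  lab_len : nat;
  lab_perm : 'S_lab_len;
  lab_fun : 'I_lab_len -> L;
  lab_mem : X lab_len lab_perm
}.

Arguments lab_fun {X L} _ _.

Definition labelled_le (X : perm_set) (L : Type) (leL : L -> L -> Prop)
    (a b : labelled X L) : Prop :=
  exists f : 'I_(lab_len a) -> 'I_(lab_len b),
    embedding (lab_perm a) (lab_perm b) f /\
    forall j, leL (lab_fun a j) (lab_fun b (f j)).

Definition lwqo (X : perm_set) : Prop :=
  forall (L : Type) (leL : L -> L -> Prop),
    wqo leL -> wqo (@labelled_le X L leL).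

(* Main.v *)
Require Import Defs.
From mathcomp Require Import all_boot all_fingroup.
From Stdlib Require Import RelationClasses Classical IndefiniteDescription.

(** A one-point extension [p] of [s] by an entry at position [d] is determined
    by [s] together with, for each entry of [s], whether it lies to the left of
    [d] and whether it lies below [p d]. Storing these two bits in the labels
    of [s], and the label of [d] itself separately, encodes labelled members of
    C^{+1} by pairs (label, labelled member of C), in such a way that
    comparable codes come from comparable labelled permutations. The codes are
    well-quasi-ordered because finite products of wqos are wqo. *)

Set Implicit Arguments.
Unset Strict Implicit.
Unset Printing Implicit Defensive.

(** * Closure properties of well-quasi-orders *)

(** Call an index terminal if no later term lies above its term. Unboundedly many terminal indices
    would form a subsequence contradicting [wqo le], so from some [N] on every index has a successor
    under [r], and iterating from [N] gives the subsequence. *)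
Lemma wqo_nondecreasing_subsequence (Y : Type) (le : Y -> Y -> Prop) :
  wqo le -> forall y : nat -> Y,
  exists g : nat -> nat, {homo g : i j / i < j} /\
    forall i j, i < j -> le (y (g i)) (y (g j)).
Proof.
move=> [[_ le_trans] le_good] y.
pose r i j := i < j /\ le (y i) (y j).
have r_trans b a c : r a b -> r b c -> r a c.
  move=> [ab lab] [bc lbc]; split; first exact: ltn_trans bc.
  exact: le_trans lbc.
have [N hN] : exists N, forall i, N <= i -> exists j, r i j.
  apply: NNPP => noN.
  have /functional_choice [t ht] :
      forall N, exists i, N <= i /\ ~ exists j, r i j.
    move=> N; apply: NNPP => hn; apply: noN; exists N => i Ni.
    by apply: NNPP => hi; apply: hn; exists i.
  pose g := fix g n := if n is m.+1 then t (g m).+1 else t 0.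
  have g_homo : {homo g : i j / i < j}.
    by apply: homo_ltn => [|i]; [exact: ltn_trans | case: (ht (g i).+1)].
  have [i [j [ij gij]]] := le_good (y \o g).
  have terminal : ~ exists k, r (g i) k.
    by case: (i) => [|m]; [have [] := ht 0 | have [] := ht (g m).+1].
  by apply: terminal; exists (g j); split; first exact: g_homo.
(* The guard [N <= i] makes the choice total; the value 0 below [N] is arbitrary. *)
have /functional_choice [next hnext] : forall i, exists j, N <= i -> r i j.
  move=> i; case: (leqP N i) => [/hN [j rij]|_]; last by exists 0.
  by exists j.
pose g n := iter n next N.
have leNg n : N <= g n.
  elim: n => //= n IHn; have [lt_next _] := hnext _ IHn.
  exact: leq_trans (ltnW lt_next).
have g_homo : {homo g : i j / i < j >-> r i j}.
  by apply: homo_ltn => // i; apply: hnext.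
by exists g; split=> i j /g_homo [].
Qed.

Lemma wqo_encoding (Y Z : Type) (leY : Y -> Y -> Prop) (leZ : Z -> Z -> Prop)
    (code : Y -> Z -> Prop) :
  PreOrder leY -> (forall y, exists z, code y z) ->
  (forall y1 y2 z1 z2, code y1 z1 -> code y2 z2 -> leZ z1 z2 -> leY y1 y2) ->
  wqo leZ -> wqo leY.
Proof.
move=> preY /functional_choice [c hc] reflects [_ goodZ]; split=> // y.
have [i [j [ij cij]]] := goodZ (c \o y).
by exists i, j; split=> //; apply: reflects cij.
Qed.

Definition prod_le (A B : Type) (leA : A -> A -> Prop) (leB : B -> B -> Prop)
    (u v : A * B) : Prop :=
  leA u.1 v.1 /\ leB u.2 v.2.

Lemma wqo_prod (A B : Type) (leA : A -> A -> Prop) (leB : B -> B -> Prop) :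
  wqo leA -> wqo leB -> wqo (prod_le leA leB).
Proof.
move=> wA [[reflB transB] goodB]; have [[reflA transA] _] := wA; split.
  split=> [u|u v w [uvA uvB] [vwA vwB]]; first by split.
  by split; [apply: transA vwA | apply: transB vwB].
move=> y; have [g [g_homo gA]] := wqo_nondecreasing_subsequence wA (fst \o y).
have [i [j [ij gB]]] := goodB (snd \o y \o g).
exists (g i), (g j); split; first exact: g_homo.
by split=> //; apply: gA.
Qed.

Definition option_le (L : Type) (leL : L -> L -> Prop) (u v : option L) :
    Prop :=
  match u, v with
  | None, None => True
  | Some a, Some b => leL a b
  | _, _ => False
  end.

(** Two occurrences of [None] are comparable; with at most one, some tail of the sequence lies in
    [L], which is wqo. *)
Lemma wqo_option (L : Type) (leL : L -> L -> Prop) :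
  wqo leL -> wqo (option_le leL).
Proof.
move=> [[reflL transL] goodL]; split.
  by split=> [[a|]|[a|] [b|] [c|]] //=; exact: transL.
move=> y.
case: (classic (exists i, y i = None)) => [[i yi]|all_some]; last first.
  case y0: (y 0) => [a0|]; last by case: all_some; exists 0.
  (* The default [a0] is never taken, since every term is a [Some]. *)
  have [i [j [ij yij]]] := goodL (odflt a0 \o y); exists i, j; split=> //.
  move: yij => /=; case yi: (y i) => [a|]; last by case: all_some; exists i.
  by case yj: (y j) => [b|] //; case: all_some; exists j.
case: (classic (exists2 j, i < j & y j = None)) => [[j ij yj]|later_some].
  by exists i, j; rewrite yi yj.
(* The shift by [i.+1] skips the only possible second [None] against [i]: every later term is a
   [Some]. *)
have some_after m : y (i.+1 + m) <> None.
  by move=> ym; apply: later_some; exists (i.+1 + m); rewrite ?leq_addr.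
case y0: (y (i.+1 + 0)) => [a0|]; last by case: (some_after 0).
have [m [n [mn ymn]]] := goodL (fun m => odflt a0 (y (i.+1 + m))).
exists (i.+1 + m), (i.+1 + n); split; first by rewrite ltn_add2l.
move: ymn (some_after m) (some_after n).
by case: (y (i.+1 + m)) => [a|] //; case: (y (i.+1 + n)).
Qed.

(** By pigeonhole, two of the first three terms agree. *)
Lemma wqo_bool : wqo (@eq bool).
Proof.
split=> [|y]; first by split=> // u v w ->.
case: (eqVneq (y 0) (y 1)) => [|n01]; first by exists 0, 1.
case: (eqVneq (y 1) (y 2)) => [|n12]; first by exists 1, 2.
by exists 0, 2; split=> //; move: n01 n12; case: (y 0) (y 1) (y 2) => [] [] [].
Qed.

(** * Embeddings and the order on labelled permutations *)

Lemma embedding_id (n : nat) (p : 'S_n) : embedding p p id.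
Proof. by split. Qed.

Lemma embedding_comp (k m n : nat) (s : 'S_k) (q : 'S_m) (p : 'S_n)
    (f : 'I_k -> 'I_m) (g : 'I_m -> 'I_n) :
  embedding s q f -> embedding q p g -> embedding s p (g \o f).
Proof.
move=> [f_incr f_iso] [g_incr g_iso]; split=> i j.
  by move=> /f_incr /g_incr.
by rewrite f_iso g_iso.
Qed.

Lemma increasing_ltn (k n : nat) (f : 'I_k -> 'I_n) :
  increasing f -> forall i j, (f i < f j) = (i < j).
Proof.
move=> f_incr i j; case: (ltngtP i j) => [/f_incr //|/f_incr ji|/val_inj ->].
  by rewrite ltnNge ltnW.
by rewrite ltnn.
Qed.

Lemma labelled_le_preorder (X : perm_set) (L : Type) (leL : L -> L -> Prop) :
  PreOrder leL -> PreOrder (@labelled_le X L leL).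
Proof.
move=> [reflL transL]; split=> [a|a b c [f [f_emb f_lab]] [g [g_emb g_lab]]].
  by exists id; split=> //; exact: embedding_id.
exists (g \o f); split; first exact: embedding_comp g_emb.
by move=> j; apply: transL (f_lab j) (g_lab (f j)).
Qed.

Lemma one_point_extension_incl (C : perm_set) (n : nat) (p : 'S_n) :
  C n p -> one_point_extension C p.
Proof.
move=> Cp; exists set0, n, p; rewrite cards0; split=> //.
exists id; split; first exact: embedding_id.
by rewrite setC0; apply/setP=> x; rewrite in_setT imset_f.
Qed.

Lemma lwqo_subset (X Y : perm_set) :
  (forall n (p : 'S_n), X n p -> Y n p) -> lwqo Y -> lwqo X.
Proof.
move=> sXY lwqoY L leL wL; have [preL _] := wL.
pose incl (a : labelled X L) : labelled Y L :=
  Labelled (lab_fun a) (sXY _ _ (lab_mem a)).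
apply: (wqo_encoding (code := fun a b => b = incl a)) (lwqoY L leL wL).
- exact: labelled_le_preorder.
- by move=> a; exists (incl a).
- by move=> a1 a2 _ _ -> ->.
Qed.

(** * Coding labelled one-point extensions *)

Section OnePointCode.

Variables (C : perm_set) (L : Type) (leL : L -> L -> Prop).

(** The value for [None] is a placeholder: [option_le] never relates [None] to a [Some], so it is
    not compared with a genuine quadrant. *)
Definition quadrant (n : nat) (p : 'S_n) (d : option 'I_n) (y : 'I_n) :
    bool * bool :=
  if d is Some x then (y < x, p y < p x) else (false, false).

(* [d] is the removed entry, if any. *)
Definition one_point_code (a : labelled (one_point_extension C) L)
    (z : option L * labelled C (L * (bool * bool))) : Prop :=
  exists (f : 'I_(lab_len z.2) -> 'I_(lab_len a)) (d : option 'I_(lab_len a)),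
    [/\ embedding (lab_perm z.2) (lab_perm a) f,
        forall x, (exists j, f j = x) <-> d <> Some x,
        z.1 = omap (lab_fun a) d
      & forall j, lab_fun z.2 j =
                  (lab_fun a (f j), quadrant (lab_perm a) d (f j))].

Lemma one_point_code_total a : exists z, one_point_code a z.
Proof.
case: a => n p l Cp; have [D [k [s [D1 [f [f_emb f_im]] Cs]]]] := Cp.
(* A set with at most one element amounts to an option. *)
have [d hd] : exists d : option 'I_n, forall x, x \in D <-> d = Some x.
  have [->|[x0 x0D]] := set_0Vmem D.
    by exists None => x; rewrite inE.
  exists (Some x0) => x; split=> [xD|[<-] //].
  by congr Some; apply: (card_le1_eqP D1).
exists (omap l d, Labelled (fun j => (l (f j), quadrant p d (f j))) Cs).
exists f, d; split=> //= x.
have -> : (exists j, f j = x) <-> x \in ~: D.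
  rewrite -f_im; split=> [[j <-]|/imsetP [j _ ->]]; last by exists j.
  exact: imset_f.
by rewrite in_setC -hd; split=> /negP.
Qed.

(** The embedding [h] of the remaining entries extends by sending the removed entry to the removed
    entry. Order is preserved because corresponding entries lie in equal quadrants. *)
Lemma one_point_code_reflects a1 a2 z1 z2 :
  one_point_code a1 z1 -> one_point_code a2 z2 ->
  prod_le (option_le leL) (labelled_le (prod_le leL eq)) z1 z2 ->
  labelled_le leL a1 a2.
Proof.
case: a1 a2 z1 z2 => [n1 p1 l1 C1] [n2 p2 l2 C2] [o1 [k1 s1 m1 B1]]
  [o2 [k2 s2 m2 B2]].
move=> [f1 [d1 [/= [f1_incr f1_iso] f1_im -> m1E]]].
move=> [f2 [d2 [/= [f2_incr f2_iso] f2_im -> m2E]]].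
move=> [/= le_d [/= h [[h_incr h_iso] le_m]]].
(* [G] is the graph of the extended embedding. *)
pose G x y := (exists2 j, x = f1 j & y = f2 (h j)) \/
    (d1 = Some x /\ d2 = Some y).
have /fin_all_exists [g gG] : forall x, exists y, G x y.
  move=> x; case: (classic (d1 = Some x)) => [d1x|/f1_im [j <-]].
    move: le_d; rewrite d1x; case: d2 {m2E f2_im} @G => [y|] // G _.
    by exists y; right.
  by exists (f2 (h j)); left; exists j.
have le_l x y : G x y -> leL (l1 x) (l2 y).
  case=> [[j -> ->]|[d1x d2y]]; last by move: le_d; rewrite d1x d2y.
  by have [] := le_m j; rewrite m1E m2E.
have ff j : quadrant p1 d1 (f1 j) = quadrant p2 d2 (f2 (h j)).
  by have [_] := le_m j; rewrite m1E m2E.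
have neq1 j x : d1 = Some x -> f1 j != x.
  by move=> d1x; apply/eqP=> fx; case: (f1_im x) => [] /(_ (ex_intro _ j fx)).
have neq2 j x : d2 = Some x -> f2 j != x.
  by move=> d2x; apply/eqP=> fx; case: (f2_im x) => [] /(_ (ex_intro _ j fx)).
have ltn_swap n (x y : 'I_n) : y != x -> (x < y) = ~~ (y < x).
  by case: ltngtP => // /val_inj ->; rewrite eqxx.
have G_iso x y x' y' : G x y -> G x' y' ->
    (x < x') = (y < y') /\ (p1 x < p1 x') = (p2 y < p2 y').
  case=> [[j -> ->]|[d1x d2y]] [[j' -> ->]|[d1x' d2y']].
  - by rewrite -f1_iso -f2_iso h_iso (increasing_ltn f1_incr)
       (increasing_ltn f2_incr) (increasing_ltn h_incr).
  - by have := ff j; rewrite d1x' d2y' /= => -[].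
  (* Quadrants record only the comparison of [f1 j'] with the removed entry; the reverse one is its
     negation, as the two entries are distinct. *)
  - have := ff j'; rewrite d1x d2y /= => -[posE valE].
    have nx := neq1 j' _ d1x; have ny := neq2 (h j') _ d2y.
    rewrite (ltn_swap _ x) // (ltn_swap _ y) // posE.
    rewrite (ltn_swap _ (p1 x)) ?(inj_eq perm_inj) //.
    by rewrite (ltn_swap _ (p2 y)) ?(inj_eq perm_inj) // valE.
  - by move: d1x' d2y'; rewrite d1x d2y => -[<-] [<-]; rewrite !ltnn.
exists g; split=> /= [|x]; last exact: le_l.
split=> x x' /=; have [posE valE] := G_iso _ _ _ _ (gG x) (gG x').
  by rewrite posE.
exact: valE.
Qed.

End OnePointCode.

Theorem theorem4p5 (C : perm_set) (hC : perm_class C) :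
  lwqo C <-> lwqo (one_point_extension C).
Proof.
split; last by apply: lwqo_subset => n p; apply: one_point_extension_incl.
move=> lwqoC L leL wL; have [preL _] := wL.
apply: (wqo_encoding (code := @one_point_code C L)).
- exact: labelled_le_preorder.
- exact: one_point_code_total.
- exact: one_point_code_reflects.
apply: wqo_prod; first exact: wqo_option.
apply: lwqoC; apply: wqo_prod => //.
(* Quadrants are ordered by equality, which on pairs is the product of the two equalities. *)
have [_ good] := wqo_prod wqo_bool wqo_bool.
split=> [|y]; first by split=> // u v w ->.
have [i [j [ij [e1 e2]]]] := good y; exists i, j; split=> //.
by rewrite [LHS]surjective_pairing e1 e2 -surjective_pairing.
Qed.
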